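(* Let $(G,X)$ be a strongly marked group with Property $\mathcal D$. For all $Y,Y'\subset X$ we have $G_Y\cap G_{Y'}=G_{Y\cap Y'}$, where $G_Z$ denotes the subgroup of $G$ generated by $Z$ for $Z\subset X$.
   Context: Notation. A marked group is a pair $(G,X)$ with $G$ a group and $X\subset G$ a generating set. $o(g)$ is the order of $g$; $\mathbb Z_{o(g)}=\mathbb Z/o(g)\mathbb Z$ if $o(g)$ is finite and $\mathbb Z_{o(g)}=\mathbb Z$ otherwise. The set of syllables is $S(X)=\{x^a\mid x\in X,\ a\in\mathbb Z_{o(x)}\setminus\{0\}\}$. $S(X)^*$ is the free monoid on $S(X)$; its elements are called syllabic words, written as finite sequences, with concatenation written $w\cdot w'$. For $w=(s_1,\dots,s_\ell)$, $\overline w=s_1\cdots s_\ell\in G$. The syllabic length $\lg_{S(X)}(g)$ is the shortest length of a syllabic word $w$ with $\overline w=g$; a word $w$ of length $\ell$ is reduced if $\ell=\lg_{S(X)}(\overline w)$. For $m\ge2$, $[a,b]_m$ is the alternating word $(a,b,a,\dots)$ of length $m$, and $\overline{[a,b]}_m$ is the alternating product $aba\cdots$ with $m$ factors. Strongly marked. $(G,X)$ is strongly marked if $1\notin X$ and, for all $x,y\in X$, $s\in\langle x\rangle\setminus\{1\}$, $t\in\langle y\rangle\setminus\{1\}$: if $st\in S(X)\cup\{1\}$ then $x=y$. M-operations. Type I: if $w=w_1\cdot(s,t)\cdot w_2$ with $s,t\in S(X)$ and $st\in S(X)\cup\{1\}$, replace $w$ by $w_1\cdot(st)\cdot w_2$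 if $st\ne1$, and by $w_1\cdot w_2$ if $st=1$. Type II: if $w=w_1\cdot[s,t]_m\cdot w_2$ with $s,t\in S(X)$, $m\ge2$, $\overline{[s,t]}_m=\overline{[t,s]}_m$ and $\lg_{S(X)}(\overline{[s,t]}_m)=m$, replace $w$ by $w_1\cdot[t,s]_m\cdot w_2$. A word is M-reduced if its length cannot be shortened by any finite sequence of elementary M-operations. Property $\mathcal D$. $(G,X)$ has Property $\mathcal D$ if (a) every $w\in S(X)^*$ is reduced if and only if it is M-reduced, and (b) for all reduced $w,w'\in S(X)^*$ with $\overline w=\overline{w'}$, one can go from $w$ to $w'$ through a finite sequence of elementary M-operations of type II. *)

(* Defs.v *)
From Stdlib Require Import Relation_Operators.
From mathcomp Require Import all_boot all_order all_algebra.
From mathcomp Require Import boolp classical_sets.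

Set Implicit Arguments.
Unset Strict Implicit.
Unset Printing Implicit Defensive.

Local Open Scope classical_set_scope.
Local Open Scope group_scope.

(* Groups are MathComp's [groupType], which may be infinite. *)

(* Minimum of a set of natural numbers, with default value 0 on the empty set. *)
Definition least (P : set nat) : nat :=
  match pselect (exists n, `[< P n >]) with
  | left exP => ex_minn exP
  | right _ => 0%N
  end.

Section MarkedGroups.
Variable G : groupType.
Implicit Types (X Z H : set G) (g x y s t : G) (w : seq G).

Definition is_subgroup H : Prop := group_closed (mem H).

Definition gen Z : set G := smallest is_subgroup Z.

(* The order o(g), where 0 encodes infinite order; since Z / 0 Z = Z, the group
   Z_{o(g)} of exponents of g is Z / (order g) Z in all cases. *)
Definition order g : nat := least [set n | (0 < n)%N /\ g ^+ n = 1].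

Definition zexpg g (a : int) : G :=
  match a with Posz n => g ^+ n | Negz n => g ^- n.+1 end.

(* A nonzero class of Z_{o(x)} is given by an integer that o(x) does not divide. *)
Definition syllables X : set G :=
  [set s | exists2 x, X x &
     exists2 a : int, ~~ ((order x : int) %| a)%Z & s = zexpg x a].

Definition syllabic_word X w : Prop := {in w, forall s, syllables X s}.

Definition wordval w : G := \prod_(s <- w) s.

(* If [X] generates [G], the set below is never empty, so the default value of
   [least] plays no role. *)
Definition lg X g : nat :=
  least [set l | exists w, [/\ syllabic_word X w, size w = l & wordval w = g]].

Definition reduced X w : Prop := size w = lg X (wordval w).

(* The alternating word (a, b, a, ...) of length m. *)
Fixpoint alt (a b : G) (m : nat) : seq G :=
  if m is m'.+1 then a :: alt b a m' else [::].

Definition marked X : Prop := gen X = setT.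

Definition strongly_marked X : Prop :=
  [/\ marked X, ~ X 1 &
      forall x y s t, X x -> X y ->
        (gen [set x] `\ 1) s -> (gen [set y] `\ 1) t ->
        (syllables X `|` [set 1]) (s * t) -> x = y].

Definition M_op_I X w w' : Prop :=
  exists w1 w2 s t,
    [/\ syllables X s, syllables X t, (syllables X `|` [set 1]) (s * t),
        w = w1 ++ [:: s; t] ++ w2 &
        w' = w1 ++ (if s * t == 1 then [::] else [:: s * t]) ++ w2].

Definition M_op_II X w w' : Prop :=
  exists w1 w2 s t m,
    [/\ syllables X s /\ syllables X t,
        (2 <= m)%N,
        wordval (alt s t m) = wordval (alt t s m)
          /\ lg X (wordval (alt s t m)) = m,
        w = w1 ++ alt s t m ++ w2 &
        w' = w1 ++ alt t s m ++ w2].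

Definition M_op X w w' : Prop := M_op_I X w w' \/ M_op_II X w w'.

Definition M_reduced X w : Prop :=
  forall w', clos_refl_trans _ (M_op X) w w' -> ~ (size w' < size w)%N.

Definition propertyD X : Prop :=
  (forall w, syllabic_word X w -> reduced X w <-> M_reduced X w) /\
  (forall w w', syllabic_word X w -> syllabic_word X w' ->
     reduced X w -> reduced X w' -> wordval w = wordval w' ->
     clos_refl_trans _ (M_op_II X) w w').

End MarkedGroups.

(* Main.v *)
(** For [Z] contained in [X], consider the words whose letters are nontrivial
    elements of the cyclic groups [<z>], [z] in [Z]. Strong marking makes this
    class stable under M-operations, because a syllable that is a product of
    two syllables comes from a single generator. By Property D(a) every element
    of [G_Z] is therefore represented by a reduced word of this class. By
    Property D(b) two reduced words with the same value are linked by type II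
    operations, which preserve the set of letters of a word; and a letter of
    both classes comes from a generator in the intersection, since
    [<y>] and [<y'>] meet trivially when [y <> y']. *)
Require Import Defs.
From mathcomp Require Import all_boot all_order all_algebra.
From mathcomp Require Import boolp classical_sets.
From Stdlib Require Import Relation_Operators.

Local Open Scope classical_set_scope.

Section Subgroups.
Local Open Scope group_scope.
Set Implicit Arguments.
Unset Strict Implicit.
Context {G : groupType}.
Implicit Types (H Z : set G) (x y : G).

Lemma is_subgroupP H :
  is_subgroup H <-> H 1 /\ (forall x y, H x -> H y -> H (x / y)).
Proof.
split=> [[H1 HB]|[H1 HB]]; split.
- exact: set_mem H1.
- by move=> x y Hx Hy; apply: set_mem; apply: HB; apply: mem_set.
- exact: mem_set.
- by move=> x y /set_mem Hx /set_mem Hy; apply/mem_set/HB.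
Qed.

Lemma gen_subgroup Z : is_subgroup (gen Z).
Proof.
apply/is_subgroupP; split=> [|x y Zx Zy] H HZ; have [/is_subgroupP[H1 HB] _] := HZ.
  exact: H1.
exact: HB (Zx _ HZ) (Zy _ HZ).
Qed.

Lemma gen_sub Z H : is_subgroup H -> Z `<=` H -> gen Z `<=` H.
Proof. by move=> Hgrp ZH; apply: smallest_sub. Qed.

Lemma gen1 Z : gen Z 1.
Proof. by have /is_subgroupP[] := gen_subgroup Z. Qed.

Lemma genV Z x : gen Z x -> gen Z x^-1.
Proof.
have /is_subgroupP[Z1 ZB] := gen_subgroup Z.
by move=> Zx; rewrite -[_^-1]mul1g; apply: ZB.
Qed.

Lemma genM Z x y : gen Z x -> gen Z y -> gen Z (x * y).
Proof.
have /is_subgroupP[Z1 ZB] := gen_subgroup Z.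
by move=> Zx /genV Zy; rewrite -[y]invgK; apply: ZB.
Qed.

Lemma gen_mono Z Z' : Z `<=` Z' -> gen Z `<=` gen Z'.
Proof.
by move=> ZZ'; apply: gen_sub (gen_subgroup _) _ => z /ZZ'; apply: sub_gen_smallest.
Qed.

End Subgroups.

Section CyclicSubgroups.
Local Open Scope group_scope.
Set Implicit Arguments.
Unset Strict Implicit.
Context {G : groupType}.
Implicit Types x s : G.

Lemma zexpgB x (m n : nat) :
  zexpg x (m%:Z - n%:Z)%R = x ^+ m / x ^+ n.
Proof.
have [le_nm|/ltnW le_mn] := leqP n m; first by rewrite subzn //= expgnFr.
(* [Negz k] encodes $-(k+1)$, so the opposite of a natural number has to be split into zero and
   successor before [zexpg] computes. *)
rewrite -GRing.opprB subzn //; case E: (n - m)%N => [|k].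
  have -> : n = m by apply/eqP; rewrite eqn_leq le_mn -subn_eq0 E.
  by rewrite mulgV.
by rewrite -[LHS]/(x ^- k.+1) -E expgnFr // invgF.
Qed.

Lemma gen_cyclic x s : gen [set x] s -> exists a : int, s = zexpg x a.
Proof.
(* Quotients of natural powers are visibly closed under division, as powers of [x] commute; this
   avoids a case analysis on the signs of integer exponents. *)
move=> xs; suff [m [n ->]] : [set s | exists m n : nat, s = x ^+ m / x ^+ n] s.
  by exists (m%:Z - n%:Z)%R; rewrite zexpgB.
apply: gen_sub xs => [|_ ->]; last first.
  by exists 1%N, 0%N; rewrite expg1 expg0 invg1 mulg1.
apply/is_subgroupP; split; first by exists 0%N, 0%N; rewrite mulgV.
move=> _ _ [m [n ->]] [p [q ->]]; exists (m + q)%N, (p + n)%N.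
rewrite !expgnDr invgF invgM !mulgA; congr (_ * _).
rewrite -!mulgA; congr (_ * _).
by apply/commute_sym/commuteV/commuteX2.
Qed.

Lemma expg_order x : x ^+ Defs.order x = 1.
Proof.
(* If no positive power of [x] is trivial, [least] returns its default value 0, and $x^0 = 1$. *)
rewrite /Defs.order /least; case: pselect => [exP|_]; last exact: expg0.
by case: ex_minnP => n /asboolP[].
Qed.

Lemma zexpg_dvd_order x (a : int) : ((Defs.order x : int) %| a)%Z -> zexpg x a = 1.
Proof.
have dvd1 k : (Defs.order x %| k)%N -> x ^+ k = 1.
  by case/dvdnP=> q ->; rewrite mulnC expgnA expg_order expg1n.
case: a => n; rewrite dvdzE /= => /dvd1 //.
by move=> xn; rewrite -[LHS]/(x ^- n.+1) xn invg1.
Qed.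

End CyclicSubgroups.

Section Letters.
Local Open Scope group_scope.
Set Implicit Arguments.
Unset Strict Implicit.
Context {G : groupType}.
Implicit Types (X Z : set G) (s t x y : G) (w : seq G).

(** Cyclic subgroups replace explicit exponents here: strong marking is stated in this form, and
    inverses and products are then handled by the subgroup laws. *)
Definition letters Z : set G :=
  [set s | exists2 z, Z z & (gen [set z] `\ 1) s].

Definition word_over Z w : Prop := {in w, forall s, letters Z s}.

Lemma letters_syllables X : letters X `<=` syllables X.
Proof.
move=> s [x Xx [xs s1]]; have [a sa] := gen_cyclic xs.
exists x => //; exists a => //; apply/negP => /zexpg_dvd_order xa1.
by apply: s1; rewrite /= sa.
Qed.

Lemma letters_gen Z : letters Z `<=` gen Z.
Proof. by move=> s [z Zz [zs _]]; apply: gen_mono zs => _ ->. Qed.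

Lemma lettersV Z s : letters Z s -> letters Z s^-1.
Proof.
case=> z Zz [zs s1]; exists z => //; split; first exact: genV.
by move=> /= /eqP; rewrite -eqg_inv invgK invg1 => /eqP.
Qed.

Lemma word_over_cat Z w1 w2 :
  word_over Z (w1 ++ w2) <-> word_over Z w1 /\ word_over Z w2.
Proof.
split=> [Zw|[Zw1 Zw2] s]; last by rewrite mem_cat => /orP[/Zw1|/Zw2].
by split=> s sw; apply: Zw; rewrite mem_cat sw ?orbT.
Qed.

Lemma word_over_gen Z w : word_over Z w -> gen Z (wordval w).
Proof.
rewrite /wordval; elim: w => [|s w IHw] Zw; first by rewrite big_nil; apply: gen1.
rewrite big_cons; apply: genM.
  by apply: (@letters_gen Z s); apply: Zw; rewrite mem_head.
by apply: IHw => t tw; apply: Zw; rewrite inE tw orbT.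
Qed.

Lemma wordval_cat w1 w2 : wordval (w1 ++ w2) = wordval w1 * wordval w2.
Proof. by rewrite /wordval big_cat. Qed.

Lemma wordvalV w : (wordval w)^-1 = wordval (rev (map monoid.inv w)).
Proof.
rewrite /wordval; elim: w => [|s w IHw]; first by rewrite /= !big_nil invg1.
by rewrite big_cons invgM IHw /= rev_cons -cats1 big_cat big_seq1.
Qed.

Lemma gen_word_over Z g :
  gen Z g -> exists2 w, word_over Z w & wordval w = g.
Proof.
apply: (@gen_sub _ _ [set g | exists2 w, word_over Z w & wordval w = g]).
  apply/is_subgroupP; split; first by exists [::]; rewrite // /wordval big_nil.
  move=> _ _ [v Zv <-] [w Zw <-]; exists (v ++ rev (map monoid.inv w)).
    apply/word_over_cat; split=> // s; rewrite mem_rev => /mapP[t tw ->].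
    exact/lettersV/Zw.
  by rewrite wordval_cat -wordvalV.
(* [Z] is arbitrary and may contain 1, which is not a letter; the empty word represents it. *)
move=> z Zz; have [->|/eqP z1] := eqVneq z 1.
  by exists [::]; rewrite // /wordval big_nil.
exists [:: z]; last by rewrite /wordval big_seq1.
move=> s; rewrite inE => /eqP ->; exists z => //.
by split=> //; apply: sub_gen_smallest.
Qed.

Lemma mem_alt s t m : (2 <= m)%N -> alt s t m =i [:: s; t].
Proof.
move=> m2 u; apply/idP/idP; last first.
  (* Length at least 2 ensures that [t] occurs as well as [s]. *)
  by case: m m2 => [|[|m]] // _; rewrite !inE => /orP[] ->; rewrite ?orbT.
elim: m s t {m2} => //= m IHm s t; rewrite inE => /predU1P[->|/IHm].
  by rewrite mem_head.
by rewrite !inE orbC.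
Qed.

Lemma M_op_II_letters X w w' : M_op_II X w w' -> w =i w'.
Proof.
case=> w1 [w2 [s [t [m [_ m2 _ -> ->]]]]] u.
by rewrite !mem_cat !mem_alt // !inE [(u == s) || _]orbC.
Qed.

Lemma M_op_II_star_letters X w w' :
  clos_refl_trans _ (M_op_II X) w w' -> w =i w'.
Proof.
elim=> [v v' /M_op_II_letters //|v //|v v' v'' _ IH1 _ IH2 u].
by rewrite IH1.
Qed.

Lemma M_op_wordval X w w' : M_op X w w' -> wordval w = wordval w'.
Proof.
case=> [[w1 [w2 [s [t [_ _ _ -> ->]]]]]|[w1 [w2 [s [t [m [_ _ [E _] -> ->]]]]]]].
  rewrite !wordval_cat; congr (_ * (_ * _)).
  by case: eqP => st; rewrite /wordval big_cons big_seq1 ?big_nil ?big_seq1.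
by rewrite !wordval_cat E.
Qed.

Lemma M_op_word_over X Z w w' :
  strongly_marked X -> Z `<=` X -> M_op X w w' ->
  word_over Z w -> word_over Z w'.
Proof.
move=> [_ _ marking] ZX [|/M_op_II_letters eqw Zw s]; last first.
  by rewrite -eqw => /Zw.
case=> w1 [w2 [s [t [_ _ Xst -> ->]]]].
move=> /word_over_cat[Zw1 /word_over_cat[Zst Zw2]].
apply/word_over_cat; split=> //; apply/word_over_cat; split=> //.
(* The only letter still to be checked is the merged one, $st \ne 1$. Strong marking identifies the
   generators of its two factors, so $st$ stays in one cyclic group $\langle x\rangle$ with $x \in
   Z$. *)
case: eqP => // st1 u; rewrite inE => /eqP ->.
have [x Zx xs] : letters Z s by apply: Zst; rewrite mem_head.
have [y Zy yt] : letters Z t by apply: Zst; rewrite !inE eqxx orbT.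
have eqxy := marking _ _ _ _ (ZX _ Zx) (ZX _ Zy) xs yt Xst.
exists x => //; split=> //; apply: genM xs.1 _.
by rewrite eqxy; case: yt.
Qed.

Lemma M_op_star_word_over X Z w w' :
  strongly_marked X -> Z `<=` X -> clos_refl_trans _ (M_op X) w w' ->
  word_over Z w -> word_over Z w' /\ wordval w' = wordval w.
Proof.
move=> hX ZX; elim=> [v v' vv' Zv|//|v v' v'' _ IH1 _ IH2 Zv].
  by split; [apply: M_op_word_over vv' Zv|rewrite (M_op_wordval vv')].
by have [Zv' <-] := IH1 Zv; apply: IH2.
Qed.

Lemma word_over_syllabic X Z w :
  Z `<=` X -> word_over Z w -> syllabic_word X w.
Proof.
move=> ZX Zw s /Zw[z Zz zs]; apply: letters_syllables.
by exists z; first exact: ZX.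
Qed.

Lemma reduced_word_over X Z g :
  strongly_marked X -> propertyD X -> Z `<=` X -> gen Z g ->
  exists w, [/\ word_over Z w, reduced X w & wordval w = g].
Proof.
move=> hX [redP _] ZX /gen_word_over[w]; have [n] := ubnP (size w).
elim: n w => // n IHn w ltwn Zw wg.
have [wred|wnred] := pselect (reduced X w); first by exists w.
(* If no suitable word existed, [w] would be M-reduced, hence reduced by Property D(a): any shorter
   word reached from [w] is over [Z] with the same value, and induction on the length applies to
   it. *)
apply: contrapT => noword; apply: wnred.
apply/redP; first exact: word_over_syllabic Zw.
move=> w' ww' ltw'w; apply: noword.
have [Zw' w'w] := M_op_star_word_over hX ZX ww' Zw.
by apply: IHn Zw' _; [apply: leq_trans ltw'w _|rewrite w'w].
Qed.

(** Strong marking is applied to $s \in \langle y\rangle$ and $s^{-1} \in \langle y'\rangle$: their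
    product 1 is allowed, which forces $y = y'$. *)
Lemma lettersI X Y Y' s :
  strongly_marked X -> Y `<=` X -> Y' `<=` X ->
  letters Y s -> letters Y' s -> letters (Y `&` Y') s.
Proof.
move=> [_ _ marking] YX Y'X [y Yy ys] /lettersV[y' Y'y' y's].
have eqy : y = y'.
  by apply: marking (YX _ Yy) (Y'X _ Y'y') ys y's _; right; rewrite /= mulgV.
by exists y => //; split=> //; rewrite eqy.
Qed.

End Letters.

Theorem corollary2p6 (G : groupType) (X : set G)
    (hX : strongly_marked X) (hD : propertyD X)
    (Y Y' : set G) (hY : Y `<=` X) (hY' : Y' `<=` X) :
  gen Y `&` gen Y' = gen (Y `&` Y').
Proof.
apply/seteqP; split=> [g [Yg Y'g]|g Ig]; last first.
  by split; apply: gen_mono Ig => z [].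
have [w [Yw wred wg]] := reduced_word_over hX hD hY Yg.
have [w' [Y'w' w'red w'g]] := reduced_word_over hX hD hY' Y'g.
have eqw : w =i w'.
  apply: (@M_op_II_star_letters _ X); apply: (proj2 hD) => //.
  - exact: word_over_syllabic Yw.
  - exact: word_over_syllabic Y'w'.
  - by rewrite wg.
(* Each letter of [w] is also a letter of [w'], so [w] itself is a word over the intersection. *)
rewrite -wg; apply: word_over_gen => s sw.
by apply: (lettersI hX hY hY'); [apply: Yw|apply: Y'w'; rewrite -eqw].
Qed.
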